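(* Suppose assumptions A0–A5 (all stated in the context) hold. Then, for an arbitrary sequence $\{x_k\}$ generated by the PIAG method, for all sufficiently small stepsizes $\alpha>0$, the following statements hold: (i) $\operatorname{dist}(x_k,\mathcal{X})\to 0$ as $k\to\infty$; (ii) the sequence of function values $\{F(x_k)\}$ is R-linearly convergent.
   Context: Problem: minimize $F(x)=\sum_{i=1}^N f_i(x)+h(x)$ over $x\in\mathbb{R}^d$, where the $f_i:\mathbb{R}^d\to\mathbb{R}$ are differentiable and possibly nonconvex, and $h$ is convex and possibly nonsmooth. Write $f=\sum_{i=1}^N f_i$. $\|\cdot\|$ is the Euclidean norm and $\langle\cdot,\cdot\rangle$ the inner product. A differentiable function $\phi$ is $M$-smooth if $\|\nabla \phi(x)-\nabla \phi(y)\|\le M\|x-y\|$ for all $x,y\in\mathbb{R}^d$. PIAG (proximal incremental aggregated gradient) method with stepsize $\alpha$ and nonnegative integer delays $\tau_k^i$: $$g_k=\sum_{i=1}^N\nabla f_i(x_{k-\tau_k^i}),\qquad x_{k+1}=\arg\min_{x\in\mathbb{R}^d}\Big\{h(x)+\langle g_k,x-x_k\rangle+\tfrac{1}{2\alpha}\|x-x_k\|^2\Big\},\qquad k\ge0,$$ with the convention $x_{-k}=x_0$ for $k\ge1$. $\operatorname{Prox}_{\phi}(y)=\arg\min_x\{\phi(x)+\frac12\|x-y\|^2\}$. The set of stationary points is $\mathcal{X}=\{x\in\mathbb{R}^d:0\in\nabla f(x)+\partial h(x)\}$, where $\partial h$ is the convex subdifferential. For a nonempty closed set $\mathcal{C}$,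 $\operatorname{dist}(x,\mathcal{C})=\inf_{y\in\mathcal{C}}\|x-y\|$. A sequence $\{u_k\}$ is R-linearly convergent to $u^\ast$ if $\limsup_{k\to\infty}\|u_k-u^\ast\|^{1/k}<1$ (with absolute value for real sequences), and R-linearly convergent if this holds for some $u^\ast$. Assumptions: A0. $F$ is bounded below. A1. For each $i=1,\dots,N$ there is a decomposition $f_i=f_i^{(1)}-f_i^{(2)}$ where $f_i^{(1)}$ is convex and $L_i$-smooth and $f_i^{(2)}$ is convex and $l_i$-smooth. Put $L=\sum_{i=1}^N L_i$, $l=\sum_{i=1}^N l_i$. Also $L_i\ge l_i$ (thus $f_i$ is $L_i$-smooth). A2. $h:\mathbb{R}^d\to(-\infty,+\infty]$ is proper, closed, convex, and $\partial h(x)\ne\emptyset$ for all $x$ with $h(x)<\infty$. A3. There is a nonnegative integer $\tau$ such that $\tau_k^i\in\{0,1,\dots,\tau\}$ for all $k\ge1$ and $i\in\{1,\dots,N\}$. A4 (proximal error bound condition). For any $\zeta\ge\inf_{x\in\mathbb{R}^d}F(x)$ there exist $\epsilon>0$ and $c_0>0$ such that $\operatorname{dist}(x,\mathcal{X})\le c_0\|\operatorname{Prox}_{\frac1L h}(x-\frac1L\nabla f(x))-x\|$ whenever $\|\operatorname{Prox}_{\frac1L h}(x-\frac1L\nabla f(x))-x\|<\epsilon$ and $F(x)\le\zeta$. A5. There exists $\delta>0$ such that $\|x-y\|\ge\delta$ whenever $x,y\in\mathcal{X}$ and $F(x)\ne F(y)$. *)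

(* Defs.v *)
From HB Require Import structures.
From mathcomp Require Import all_boot all_order all_algebra.
From mathcomp Require Import all_classical all_reals all_analysis.
Set Implicit Arguments.
Unset Strict Implicit.
Unset Printing Implicit Defensive.
Import Order.TTheory GRing.Theory Num.Theory.
Import numFieldNormedType.Exports.
Local Open Scope classical_set_scope.
Local Open Scope ring_scope.

Section Euclidean.
Variables (R : realType) (d : nat).
Implicit Types (u v x y : 'rV[R]_d) (C : set 'rV[R]_d).

Definition dot u v : R := \sum_(j < d) u 0 j * v 0 j.

(* The library norm on 'rV[R]_d is the sup norm; the two norms are equivalent,
   so differentiability and topological notions are unaffected. *)
Definition enorm u : R := Num.sqrt (dot u u).

(* Extended-valued, so that the distance to the empty set is +oo, not 0. *)
Definition dist x C : \bar R := ereal_inf [set (enorm (x - y))%:E | y in C].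

Definition grad (phi : 'rV[R]_d -> R) x : 'rV[R]_d :=
  \row_(j < d) 'D_(delta_mx 0 j) phi x.

Definition differentiable_fun (phi : 'rV[R]_d -> R) : Prop :=
  forall x, differentiable phi x.

Definition smooth (M : R) (phi : 'rV[R]_d -> R) : Prop :=
  differentiable_fun phi /\
  forall x y, enorm (grad phi x - grad phi y) <= M * enorm (x - y).

Definition convex_real (phi : 'rV[R]_d -> R) : Prop :=
  convex_function [set: convex_lmodType 'rV[R]_d] phi.

End Euclidean.

Section ExtendedValued.
Variables (R : realType) (d : nat).
Implicit Types (phi h : 'rV[R]_d -> \bar R) (x y u g : 'rV[R]_d).
Local Open Scope ereal_scope.

Definition proper_fun phi : Prop :=
  (forall x, -oo < phi x) /\ exists x, phi x < +oo.

(* Closed in the sense of convex analysis: the epigraph is closed. *)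
Definition closed_fun phi : Prop :=
  closed [set p : 'rV[R]_d * R | phi p.1 <= p.2%:E].

(* Meant for functions that never take the value -oo; recall 0 * +oo = 0. *)
Definition convex_ereal phi : Prop :=
  forall x y (t : R), (0 <= t <= 1)%R ->
    phi (t *: x + (1 - t) *: y)%R <= t%:E * phi x + (1 - t)%:E * phi y.

(* For proper phi this is empty wherever phi x = +oo. *)
Definition subdiff phi x : set 'rV[R]_d :=
  [set g | forall y, phi x + (dot g (y - x))%:E <= phi y].

Definition argmin phi : set 'rV[R]_d :=
  [set x | forall y, phi x <= phi y].

(* The minimizer exists and is unique when phi is proper, closed and convex;
   [get] returns a default value if there is none. *)
Definition prox phi y : 'rV[R]_d :=
  get (argmin (fun x => phi x + (2^-1 * enorm (x - y) ^+ 2)%:E)).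

End ExtendedValued.

Section Problem.
Variables (R : realType) (d N : nat).
Variables (f : 'I_N -> 'rV[R]_d -> R) (h : 'rV[R]_d -> \bar R).

Definition fsum (x : 'rV[R]_d) : R := \sum_(i < N) f i x.

Definition objective (x : 'rV[R]_d) : \bar R := ((fsum x)%:E + h x)%E.

Definition stationary : set 'rV[R]_d :=
  [set x | exists2 g, subdiff h x g & grad fsum x + g = 0].

Definition dc_smooth (Ls ls : 'I_N -> R) : Prop :=
  exists f1 f2 : 'I_N -> 'rV[R]_d -> R, forall i,
    [/\ forall x, f i x = f1 i x - f2 i x,
        convex_real (f1 i) /\ smooth (Ls i) (f1 i),
        convex_real (f2 i) /\ smooth (ls i) (f2 i)
      & ls i <= Ls i].

(* Prox_{h/L}(x - grad f(x) / L) - x *)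
Definition prox_residual (L : R) (x : 'rV[R]_d) : 'rV[R]_d :=
  prox (fun u => (L^-1)%:E * h u)%E (x - L^-1 *: grad fsum x) - x.

Definition prox_error_bound (L : R) : Prop :=
  forall zeta : R, (ereal_inf (range objective) <= zeta%:E)%E ->
  exists eps c0 : R, [/\ 0 < eps, 0 < c0 &
    forall x, enorm (prox_residual L x) < eps -> (objective x <= zeta%:E)%E ->
      (dist x stationary <= (c0 * enorm (prox_residual L x))%:E)%E].

Definition value_separation : Prop :=
  exists2 delta : R, 0 < delta &
    forall x y, stationary x -> stationary y -> objective x <> objective y ->
      delta <= enorm (x - y).

(* Truncated subtraction on nat implements the convention x_{-k} = x_0. *)
Definition agg_grad (tau : nat -> 'I_N -> nat) (x : nat -> 'rV[R]_d) (k : nat) :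
    'rV[R]_d :=
  \sum_(i < N) grad (f i) (x (k - tau k i)%N).

Definition PIAG (alpha : R) (tau : nat -> 'I_N -> nat) (x : nat -> 'rV[R]_d) :
    Prop :=
  forall k, argmin (fun u =>
      h u + (dot (agg_grad tau x k) (u - x k)
             + (2 * alpha)^-1 * enorm (u - x k) ^+ 2)%:E)%E (x k.+1).

End Problem.

(* limsup_k |u_k - l|^{1/k} < 1. Extended-valued u, since finitely many terms
   may be +oo; the term k = 0, where k^-1 = 0, is irrelevant to the limsup. *)
Definition R_linear_to (R : realType) (u : nat -> \bar R) (l : R) : Prop :=
  (limn_esup (fun k => poweR `|u k - l%:E| (k%:R^-1)%R) < 1)%E.

Definition R_linear (R : realType) (u : nat -> \bar R) : Prop :=
  exists l : R, R_linear_to u l.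

(* Main.v *)
Require Import Defs.
From HB Require Import structures.
From mathcomp Require Import all_boot all_order all_algebra.
From mathcomp Require Import all_classical all_reals all_analysis.
From mathcomp Require Import ring lra.
Set Implicit Arguments.
Unset Strict Implicit.
Unset Printing Implicit Defensive.
Import Order.TTheory GRing.Theory Num.Theory.
Import numFieldNormedType.Exports.
Local Open Scope classical_set_scope.
Local Open Scope ring_scope.

(** The convexity of the [f i] plays no role: each gradient is Lipschitz, so by
    the mean value theorem [f] differs from its linearization at [x] by at most
    [M |y - x|^2]. Write [r_k = |x_(k+1) - x_k|] and [S_k = sum_(s <= T) r_(k-s)^2].
    Strong convexity of the proximal subproblem and the bound [M T sqrt S_k] on
    the gradient error show that, for small [alpha], the objective plus weighted
    past steps, [W_k = F (x_k) + (b + 1) sum_(s < T) (T - s) r_(k-1-s)^2],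
    decreases by at least [S_k]. Hence [S_k -> 0]. The proximal residual is
    [O(sqrt S_k)], so the error bound places a stationary point within
    [O(sqrt S_k)] of [x_k]; by separation all these points share one value [l].
    Comparing with them, [W_(k+1) - l <= C S_k] and [l - F (x_k) <= C S_k],
    and together with the decrease this forces geometric convergence. *)

(** * Inner product and Euclidean norm *)

Section InnerProduct.
Variables (R : realType) (d : nat).
Implicit Types (u v w x y z : 'rV[R]_d) (c : R).

Lemma dotC u v : dot u v = dot v u.
Proof. by apply: eq_bigr => j _; rewrite mulrC. Qed.

Lemma dotDl u v w : dot (u + v) w = dot u w + dot v w.
Proof. by rewrite -big_split; apply: eq_bigr => j _; rewrite mxE mulrDl. Qed.

Lemma dotZl c u v : dot (c *: u) v = c * dot u v.
Proof. by rewrite mulr_sumr; apply: eq_bigr => j _; rewrite mxE mulrA. Qed.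

Lemma dotNl u v : dot (- u) v = - dot u v.
Proof. by rewrite -scaleN1r dotZl mulN1r. Qed.

Lemma dotDr u v w : dot u (v + w) = dot u v + dot u w.
Proof. by rewrite dotC dotDl ![dot _ u]dotC. Qed.

Lemma dotZr c u v : dot u (c *: v) = c * dot u v.
Proof. by rewrite dotC dotZl dotC. Qed.

Lemma dotNr u v : dot u (- v) = - dot u v.
Proof. by rewrite dotC dotNl dotC. Qed.

Definition dotE := (dotDl, dotDr, dotNl, dotNr, dotZl, dotZr).

Lemma dot_ge0 u : 0 <= dot u u.
Proof. by apply: sumr_ge0 => j _; rewrite -expr2 sqr_ge0. Qed.

Lemma enorm_ge0 u : 0 <= enorm u.
Proof. exact: sqrtr_ge0. Qed.

Lemma enorm_sqr u : enorm u ^+ 2 = dot u u.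
Proof. by rewrite sqr_sqrtr ?dot_ge0. Qed.

Lemma enormN u : enorm (- u) = enorm u.
Proof. by rewrite /enorm dotNl dotNr opprK. Qed.

Lemma enormB u v : enorm (u - v) = enorm (v - u).
Proof. by rewrite -enormN opprB. Qed.

Lemma enorm0 : enorm (0 : 'rV[R]_d) = 0.
Proof. by rewrite /enorm -(scale0r 0) dotZl mul0r sqrtr0. Qed.

Lemma enormZ c u : enorm (c *: u) = `|c| * enorm u.
Proof.
by rewrite /enorm dotZl dotZr mulrA -expr2 sqrtrM ?sqr_ge0// sqrtr_sqr.
Qed.

(** Cauchy-Schwarz: the square norm of [dot v v *: u - dot u v *: v] is [dot v v] times the defect
    [dot u u * dot v v - dot u v ^+ 2], so this defect is nonnegative unless [v] vanishes, a case
    treated first. *)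
Lemma dot_le_enorm u v : dot u v <= enorm u * enorm v.
Proof.
suff h : dot u v ^+ 2 <= dot u u * dot v v.
  rewrite /enorm -sqrtrM ?dot_ge0// (le_trans (ler_norm _))//.
  by rewrite -sqrtr_sqr ler_wsqrtr.
have [v0|v0] := eqVneq (dot v v) 0.
  suff -> : dot u v = 0 by rewrite expr0n/= v0 mulr0.
  move: v0 => /eqP; rewrite psumr_eq0 => [/allP v0|j _]; last exact: sqr_ge0.
  rewrite /dot big1// => j _; have := v0 j (mem_index_enum j).
  by rewrite -expr2 sqrf_eq0 => /eqP ->; rewrite mulr0.
have vp : 0 < dot v v by rewrite lt0r v0 dot_ge0.
have := dot_ge0 (dot v v *: u - dot u v *: v); rewrite !dotE (dotC v u) => h.
by rewrite -subr_ge0 -(pmulr_rge0 _ vp); apply: le_trans h _; lra.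
Qed.

Lemma normr_dot_le u v : `|dot u v| <= enorm u * enorm v.
Proof.
by rewrite ler_norml dot_le_enorm lerNl -dotNl -(enormN u) dot_le_enorm.
Qed.

Lemma enormD u v : enorm (u + v) <= enorm u + enorm v.
Proof.
rewrite -(@ler_pXn2r _ 2) ?nnegrE ?addr_ge0 ?enorm_ge0//.
rewrite sqrrD !enorm_sqr !dotE (dotC v u); have := dot_le_enorm u v; lra.
Qed.

Lemma enorm_triangle y x z : enorm (x - z) <= enorm (x - y) + enorm (y - z).
Proof. by rewrite (le_trans _ (enormD _ _))// addrA subrK. Qed.

Lemma enorm_sum (I : finType) (F : I -> 'rV[R]_d) :
  enorm (\sum_i F i) <= \sum_i enorm (F i).
Proof.
elim/big_rec2: _ => [|i a b _ ih]; first by rewrite enorm0.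
by rewrite (le_trans (enormD _ _))// lerD2l.
Qed.

Lemma normr_coord_le u j : `|u 0 j| <= enorm u.
Proof.
rewrite -sqrtr_sqr ler_wsqrtr// /dot (bigD1 j)//= -expr2 lerDl.
by apply: sumr_ge0 => i _; rewrite -expr2 sqr_ge0.
Qed.

Lemma dot_continuous (T : Type) (F : set_system T) (FF : Filter F)
    (a b : T -> 'rV[R]_d) u v :
  a @ F --> u -> b @ F --> v -> (fun t => dot (a t) (b t)) @ F --> dot u v.
Proof.
move=> au bv.
have coord (c : T -> 'rV[R]_d) w j : c @ F --> w -> (fun t => c t 0 j) @ F --> w 0 j.
  move=> cw.
  apply: (@continuous_cvg _ _ _ _ _ c (fun A : 'rV[R]_d => A 0 j) w _ cw).
  exact: coord_continuous.
rewrite /dot; apply: cvg_big => [|j _]; first exact: add_continuous.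
by apply: cvgM; exact: coord.
Qed.

End InnerProduct.

(** * Gradients and first-order estimates for smooth functions *)

Section Smooth.
Variables (R : realType) (d : nat).
Implicit Types (phi psi : 'rV[R]_d -> R) (x y v : 'rV[R]_d) (M : R).

Lemma dot_grad phi x v : differentiable phi x -> dot (grad phi x) v = 'D_v phi x.
Proof.
move=> dphi; rewrite deriveE// [in RHS](row_sum_delta v) linear_sum /dot.
by apply: eq_bigr => j _; rewrite linearZ mxE deriveE// mulrC.
Qed.

Lemma gradB phi psi x : differentiable phi x -> differentiable psi x ->
  grad (phi - psi) x = grad phi x - grad psi x.
Proof.
by move=> dp dq; apply/rowP => j; rewrite !mxE deriveB//; exact: diff_derivable.
Qed.

Lemma grad_sum N (f : 'I_N -> 'rV[R]_d -> R) x :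
  (forall i, differentiable (f i) x) ->
  grad (fsum f) x = \sum_(i < N) grad (f i) x.
Proof.
move=> df; apply/rowP => j; rewrite summxE mxE.
have -> : fsum f = \sum_(i < N) f i by apply/funext => z; rewrite fct_sumE.
rewrite derive_sum => [|i]; last exact: diff_derivable.
by apply: eq_bigr => i _; rewrite mxE.
Qed.

Lemma grad_mean_value phi x y : differentiable_fun phi ->
  exists2 t, 0 <= t <= 1 &
    phi y - phi x = dot (grad phi (x + t *: (y - x))) (y - x).
Proof.
move=> dphi; pose g (t : R) := phi (x + t *: (y - x)).
have dg (t : R) : is_derive t 1 g (dot (grad phi (x + t *: (y - x))) (y - x)).
  (* The difference quotients of [g] at [t] are those of [phi] in the direction [y - x]. *)
  have quot : (fun e : R => e^-1 *: ((g \o shift t) e%:A - g t)) =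
      (fun e : R => e^-1 *: ((phi \o shift (x + t *: (y - x))) (e *: (y - x))
                             - phi (x + t *: (y - x)))).
    apply/funext => e; rewrite /g /= [_%:A]mulr1; congr (_ *: (phi _ - _)).
    by rewrite scalerDl addrCA.
  rewrite dot_grad//; apply: DeriveDef; last by rewrite /derive quot.
  by rewrite /derivable quot; exact: diff_derivable.
have [|t] := @MVT_segment R g _ 0 1 ler01 (fun t _ => dg t).
  by apply: derivable_within_continuous => t _; have [] := dg t.
rewrite in_itv/= => t01; rewrite /g scale1r scale0r addr0 subr0 mulr1.
by rewrite [x + _]addrC subrK => ->; exists t.
Qed.

(** By the mean value theorem the linearization error is a difference of gradients tested against
    [y - x]. This costs a factor 2 compared with integrating along the segment, but gives both signs
    at once. *)
Lemma smooth_bregman_le phi M x y : 0 <= M -> smooth M phi ->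
  `|phi y - phi x - dot (grad phi x) (y - x)| <= M * enorm (y - x) ^+ 2.
Proof.
move=> M0 [dphi lip].
have [t /andP[t0 t1] ->] := grad_mean_value x y dphi.
rewrite -dotNl -dotDl (le_trans (normr_dot_le _ _))// expr2 mulrA.
rewrite ler_wpM2r ?enorm_ge0// (le_trans (lip _ _))// ler_wpM2l//.
rewrite addrC addKr enormZ ger0_norm//.
by rewrite ler_piMl ?enorm_ge0.
Qed.

End Smooth.

(** * Minimizers of [h] plus a quadratic model *)

Section ProximalModel.
Variables (R : realType) (d : nat) (h : 'rV[R]_d -> \bar R).
Hypotheses (h_proper : proper_fun h) (h_convex : convex_ereal h).
Implicit Types (g p s u v x z : 'rV[R]_d) (c t : R).

(** A PIAG step uses [c = (2 * alpha)^-1] and the aggregated gradient; the proximal residual uses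
    [c = L / 2] and the exact gradient. *)
Definition qmodel g z c u : R := dot g (u - z) + c * enorm (u - z) ^+ 2.

Lemma proper_fin_num u : (h u < +oo)%E -> h u \is a fin_num.
Proof. by move=> hu; rewrite fin_numE gt_eqF ?lt_eqF//; apply: h_proper.1. Qed.

Lemma qmodel_conv g z c u v t :
  qmodel g z c (t *: u + (1 - t) *: v) =
  t * qmodel g z c u + (1 - t) * qmodel g z c v - c * t * (1 - t) * enorm (u - v) ^+ 2.
Proof.
rewrite /qmodel !enorm_sqr !dotE (dotC v u) (dotC z u) (dotC z v); ring.
Qed.

Lemma model_strongly_convex g z c u v t : 0 <= t <= 1 ->
  h u \is a fin_num -> h v \is a fin_num ->
  h (t *: u + (1 - t) *: v) \is a fin_num /\
  fine (h (t *: u + (1 - t) *: v)) + qmodel g z c (t *: u + (1 - t) *: v) <=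
  t * (fine (h u) + qmodel g z c u) + (1 - t) * (fine (h v) + qmodel g z c v)
  - c * t * (1 - t) * enorm (u - v) ^+ 2.
Proof.
move=> t01 hu hv; have := h_convex u v t01.
rewrite -{1}(fineK hu) -{1}(fineK hv) -!EFinM -EFinD => hw.
have wfin : h (t *: u + (1 - t) *: v) \is a fin_num.
  by apply: proper_fin_num; rewrite (le_lt_trans hw)// ltry.
split=> //; rewrite -(fineK wfin) lee_fin in hw.
by rewrite qmodel_conv; lra.
Qed.

(* Minimality is tested along the segment from [p] to [u], close to [p]. *)
Lemma argmin_three_point g z c p : 0 <= c ->
  argmin (fun u => h u + (qmodel g z c u)%:E)%E p ->
  h p \is a fin_num /\ forall u, h u \is a fin_num ->
    fine (h p) + qmodel g z c p + c * enorm (u - p) ^+ 2 <=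
    fine (h u) + qmodel g z c u.
Proof.
move=> c0 pmin.
have pfin : h p \is a fin_num.
  have [_ [x hx]] := h_proper; apply: proper_fin_num.
  have := pmin x; rewrite -(fineK (proper_fin_num hx)) -EFinD.
  by case: (h p) (h_proper.1 p) => //= [r|] _; rewrite ?ltry.
split=> // u ufin; apply/ler_addgt0Pr => e e0.
set D := enorm (u - p) ^+ 2; have D0 : 0 <= D by rewrite sqr_ge0.
(* Strong convexity divided by [t] gives [a + c * (1 - t) * D <= b], for the model values [a] at [p]
   and [b] at [u]; this [t] makes the loss [t * c * D] at most [e]. *)
pose t := e / (e + c * D).
have cD0 : 0 <= c * D by rewrite mulr_ge0.
have eD : 0 < e + c * D by lra.
have t0 : 0 < t by rewrite divr_gt0.
have t1 : t <= 1 by rewrite ler_pdivrMr// mul1r; lra.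
have tcD : t * (c * D) <= e.
  by rewrite /t mulrAC ler_pdivrMr// ler_wpM2l ?(ltW e0)//; lra.
have t01 : 0 <= t <= 1 by rewrite (ltW t0).
have [wfin] := model_strongly_convex g z c t01 ufin pfin.
have := pmin (t *: u + (1 - t) *: p).
rewrite -(fineK wfin) -(fineK pfin) -!EFinD lee_fin /= -/D.
set w := (fine (h (_ + _)) + _); set a := (_ + qmodel _ _ _ p).
set b := (_ + qmodel _ _ _ u) => aw wab.
have : t * (a + c * D) <= t * (b + e).
  have -> : t * (b + e) = t * b + t * e by ring.
  have : t * (t * (c * D)) <= t * e by rewrite ler_wpM2l// ltW.
  lra.
by rewrite ler_pM2l.
Qed.

(** A subgradient bounds the model below, strong convexity makes a minimizing sequence Cauchy, and
    the closed epigraph keeps the limit minimal. Existence gives meaning to [prox], which is defined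
    by [get]. *)
Lemma argmin_model_exists g z c : closed_fun h -> 0 < c ->
  (exists2 x, (h x < +oo)%E & subdiff h x !=set0) ->
  argmin (fun u => h u + (qmodel g z c u)%:E)%E !=set0.
Proof.
move=> h_closed c0 [x hx [s hs]].
have xfin := proper_fin_num hx.
pose val u := fine (h u) + qmodel g z c u.
pose E := [set val u | u in [set u | h u \is a fin_num]].
have Einf : has_inf E.
  split; first by exists (val x), x.
  (* The affine minorant of [h] plus the model is a quadratic in [u - z]; completing the square
     gives its minimum. *)
  exists (fine (h x) + dot s (z - x) - (4 * c)^-1 * dot (s + g) (s + g)).
  move=> _ [u /= ufin <-].
  have hu : fine (h x) + dot s (u - x) <= fine (h u).
    by rewrite -lee_fin EFinD !fineK//; exact: hs.
  have sq : 0 <= (4 * c)^-1 *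
      dot (s + g + (2 * c) *: (u - z)) (s + g + (2 * c) *: (u - z)).
    by rewrite mulr_ge0 ?dot_ge0// invr_ge0 mulr_ge0 ?ltW.
  rewrite (le_trans _ (lerD hu (lexx _)))// /qmodel enorm_sqr -subr_ge0.
  apply: (le_trans sq); rewrite le_eqVlt; apply/orP; left; apply/eqP.
  rewrite !dotE (dotC g s) (dotC u s) (dotC z s) (dotC u g) (dotC z g) (dotC z u).
  by field; rewrite gt_eqF.
pose m := inf E.
have m_le u : h u \is a fin_num -> m <= val u.
  by move=> ufin; apply: ge_inf; [exact: Einf.2|exists u].
have /choice[u_ hu_] n : exists u, h u \is a fin_num /\ val u < m + n.+1%:R^-1.
  have [|_ [u ufin <-] lt_m] := @inf_adherent _ E n.+1%:R^-1 _ Einf.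
    by rewrite invr_gt0.
  by exists u.
have u_fin n := (hu_ n).1.
(* The midpoint of [u_ n] and [u_ k] has value at least [m], while strong convexity puts it
   [c / 4 * enorm (u_ n - u_ k) ^+ 2] below the mean of the two values. *)
have u_dist n k : c * enorm (u_ n - u_ k) ^+ 2 <= 2 * (n.+1%:R^-1 + k.+1%:R^-1).
  have h01 : 0 <= (2^-1 : R) <= 1 by lra.
  have [wfin] := model_strongly_convex g z c h01 (u_fin n) (u_fin k).
  have := m_le _ wfin; rewrite /val; have := (hu_ n).2; have := (hu_ k).2.
  rewrite /val; move: (_ ^+ 2) n.+1%:R^-1 k.+1%:R^-1 => D a b.
  set w := fine (h (_ + _)); set q := qmodel _ _ _ (_ + _); lra.
have u_cvg : cvgn u_.
  apply/cauchy_cvgP/cauchy_ballP => e e0.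
  have : (fun n => 2 * (@harmonic R n + harmonic n)) @ \oo --> (2 * (0 + 0) : R).
    by apply: cvgM; [exact: cvg_cst|apply: cvgD; exact: cvg_harmonic].
  rewrite addr0 mulr0 => /cvgr_lt/(_ (c * e ^+ 2)).
  move=> /(_ (mulr_gt0 c0 (exprn_gt0 2 e0))).
  move=> [K _ hK].
  have small n : (K <= n)%N -> n.+1%:R^-1 <= K.+1%:R^-1 :> R.
    by move=> Kn; rewrite lef_pV2 ?posrE// ler_nat.
  pose tail := u_ @` [set n | (K <= n)%N].
  exists (tail, tail) => [|[_ _] /= [[n Kn <-] [k Kk <-]]].
    by split; exists K => // n Kn; exists n.
  rewrite -ball_normE /= [ltLHS]/Num.Def.normr /= mx_normrE.
  apply/bigmax_ltP; split=> // -[i j] _ /=.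
  rewrite ord1 (le_lt_trans (_ : _ <= enorm (u_ n - u_ k)))//.
    exact: le_trans (normr_coord_le _ _).
  rewrite -(@ltr_pXn2r _ 2) ?nnegrE ?enorm_ge0 ?ltW// -(ltr_pM2l c0).
  rewrite (le_lt_trans (u_dist _ _))// (le_lt_trans _ (hK K (leqnn K)))//.
  by rewrite ler_pM2l// lerD// small.
pose p := limn u_.
have q_cvg : qmodel g z c (u_ n) @[n --> \oo] --> qmodel g z c p.
  have uz : (u_ n - z) @[n --> \oo] --> p - z by apply: cvgB => //; exact: cvg_cst.
  rewrite /qmodel enorm_sqr; under eq_fun do rewrite enorm_sqr.
  apply: cvgD; first by apply: dot_continuous => //; exact: cvg_cst.
  by apply: cvgM; [exact: cvg_cst|exact: dot_continuous].
have val_cvg : val (u_ n) @[n --> \oo] --> m.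
  apply: (@squeeze_cvgr _ _ _ _ (cst m) (fun n => m + harmonic n)).
  - by apply: nearW => n; rewrite m_le//= ltW//; exact: (hu_ n).2.
  - exact: cvg_cst.
  - by rewrite -[X in _ --> X]addr0; apply: cvgD; [exact: cvg_cst|exact: cvg_harmonic].
(* The points [(u_ n, h (u_ n))] of the epigraph converge to [(p, m - qmodel g z c p)]. *)
have hp : (h p <= (m - qmodel g z c p)%:E)%E.
  apply: (@closed_cvg _ _ \oo _ (fun n => (u_ n, val (u_ n) - qmodel g z c (u_ n)))
    _ h_closed _ (p, m - qmodel g z c p)).
    by apply: nearW => n /=; rewrite /val addrK fineK.
  apply: (@cvg_pair _ _ _ \oo (nbhs p) (nbhs (m - qmodel g z c p)) _ _ _ u_
    (fun n => val (u_ n) - qmodel g z c (u_ n))) => //; exact: cvgB.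
exists p => v.
have [vfin|] := boolP (h v \is a fin_num).
  rewrite -[in leRHS](fineK vfin) -EFinD.
  rewrite (le_trans (leeD2r _ hp))// -EFinD subrK lee_fin.
  exact: m_le.
rewrite fin_numE negb_and !negbK => /orP[/eqP hv|/eqP ->]; last by rewrite addye ?leey.
by have := h_proper.1 v; rewrite hv.
Qed.

End ProximalModel.

(** * Real sequences: Lyapunov function and geometric rates *)

Section Sequences.
Variable R : realType.
Implicit Types (D S V W : nat -> R) (T k : nat).

(* Used with [s = sqrt S_k]: the points given by the error bound are only at
   distance less than [K r] for each [r > s], as [dist] need not be attained. *)
Lemma le_sqr_right_limit (A C s r0 : R) : 0 <= C -> 0 <= s < r0 ->
  (forall r, s < r < r0 -> A <= C * r ^+ 2) -> A <= C * s ^+ 2.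
Proof.
move=> C0 /andP[s0 sr0] hA; apply/ler_addgt0Pr => e e0.
(* Moving from [s] to [s + t < r0] costs [C * t * (2 * s + t) <= t * B]; the summand 1 keeps [B]
   positive. *)
pose B := C * (2 * r0) + 1.
have B0 : 0 < B by rewrite ltr_wpDl// !mulr_ge0// ltW// (le_lt_trans s0).
pose t := Num.min ((r0 - s) / 2) (e / B).
have t0 : 0 < t by rewrite lt_min !divr_gt0// subr_gt0.
have tr : t <= (r0 - s) / 2 by rewrite ge_min lexx.
have te : t * B <= e by rewrite -ler_pdivlMr// ge_min lexx orbT.
have : A <= C * (s + t) ^+ 2 by apply: hA; lra.
move=> /le_trans; apply.
have : C * (t * (2 * s + t)) <= C * (t * (2 * r0)).
  by rewrite ler_wpM2l// ler_pM2l//; lra.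
by rewrite /B in te; lra.
Qed.

(* [k.-1 - s] for [s < T] lists the [T] indices before [k], with 0 repeated. *)
Definition window T D k : R := \sum_(s < T) D (k.-1 - s)%N.

Definition lyapunov T (b : R) V D k : R :=
  V k + b * \sum_(s < T) (T - s)%:R * D (k.-1 - s)%N.

Lemma window_ge0 T D k : (forall j, 0 <= D j) -> 0 <= window T D k.
Proof. by move=> D0; apply: sumr_ge0. Qed.

Lemma window_ge_term T D k (s : 'I_T) :
  (forall j, 0 <= D j) -> D (k.-1 - s)%N <= window T D k.
Proof.
by move=> D0; rewrite /window (bigD1 s)//= lerDl; apply: sumr_ge0.
Qed.

(** Advancing [k] lowers the weight of each old term by one, which removes one [window], and [D k]
    enters with weight [T]. *)
Lemma lyapunovS T b V D k : lyapunov T b V D k.+1 =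
  lyapunov T b V D k + (V k.+1 - V k) + b * (T%:R * D k - window T D k).
Proof.
suff -> : lyapunov T b V D k.+1 = V k.+1 + b * (T%:R * D k - window T D k +
    \sum_(s < T) (T - s)%:R * D (k.-1 - s)%N) by rewrite /lyapunov; ring.
rewrite /lyapunov; congr (_ + b * _) => /=.
transitivity (\sum_(s < T.+1) (T - s)%:R * D (k - s)%N).
  by rewrite big_ord_recr/= subnn mul0r addr0.
rewrite big_ord_recl !subn0 -addrA; congr (_ + _).
rewrite /window addrC -sumrB; apply: eq_bigr => s _.
rewrite lift0 subnS -subn1 natrB ?subn_gt0// mulrBl mul1r.
by rewrite subnS -subn1 subnAC subn1.
Qed.

(** Of the weight [b + 1], the part [b] cancels the delay error and the remaining unit leaves
    [window T D k] as a net decrease. *)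
Lemma lyapunov_decrease T a b V D k :
  (forall j, 0 <= D j) -> (b + 1) * T%:R + 1 <= a ->
  V k.+1 <= V k - a * D k + b * window T D k ->
  lyapunov T (b + 1) V D k.+1 <= lyapunov T (b + 1) V D k - (D k + window T D k).
Proof.
move=> D0 ab dec; rewrite lyapunovS.
by have := ler_wpM2r (D0 k) ab; lra.
Qed.

Lemma lyapunov_ge T b V D k : 0 <= b -> (forall j, 0 <= D j) ->
  V k <= lyapunov T b V D k.
Proof.
move=> b0 D0; rewrite lerDl mulr_ge0// sumr_ge0// => s _.
by rewrite mulr_ge0.
Qed.

Lemma lyapunovS_le T b V D k : 0 <= b -> (forall j, 0 <= D j) ->
  lyapunov T b V D k.+1 <= V k.+1 + b * (T%:R * (D k + window T D k)).
Proof.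
move=> b0 D0; rewrite lerD2l ler_wpM2l//=.
have -> : D k + window T D k = \sum_(s < T.+1) D (k - s)%N.
  rewrite big_ord_recl subn0; congr (_ + _); apply: eq_bigr => s _.
  by rewrite lift0 -subn1 -subnDA add1n.
rewrite big_ord_recr/= mulrDr mulr_sumr -[leLHS]addr0 lerD ?mulr_ge0//.
by apply: ler_sum => s _; rewrite ler_wpM2r// ler_nat leq_subr.
Qed.

Lemma decrements_cvg0 V S m K :
  (forall k, (K <= k)%N -> 0 <= S k) -> (forall k, (K <= k)%N -> m <= V k) ->
  (forall k, (K <= k)%N -> V k.+1 <= V k - S k) -> S @ \oo --> 0.
Proof.
move=> S0 Vm dec; rewrite -(cvg_shiftn K); pose U n := V (n + K)%N.
have le_K n : (K <= n + K)%N by rewrite leq_addl.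
have U_cvg : cvgn U.
  apply: nonincreasing_is_cvgn.
    apply/nonincreasing_seqP => n; rewrite /U addSn (le_trans (dec _ (le_K n)))//.
    by rewrite gerBl S0.
  by exists m => _ [n _ <-]; exact: Vm.
apply: (@squeeze_cvgr _ _ _ _ (cst 0) (fun n => U n - U n.+1)).
- apply: nearW => n; rewrite /= S0//=; have := dec _ (le_K n).
  by rewrite /U addSn; lra.
- exact: cvg_cst.
- by rewrite -(subrr (limn U)); apply: cvgB => //; rewrite cvg_shiftS.
Qed.

(** Since [S k <= W k - W k.+1], the bound [W k.+1 - l <= C * S k] turns into a contraction of
    [W - l] with factor [C / (1 + C)]. That [l <= W k] follows from [low] and [S] tending to 0, as
    [W] is nonincreasing. *)
Lemma geometric_rate V W S l C K : 0 < C -> S @ \oo --> 0 ->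
  (forall k, (K <= k)%N -> 0 <= S k) ->
  (forall k, (K <= k)%N -> W k.+1 <= W k - S k) ->
  (forall k, (K <= k)%N -> W k.+1 - l <= C * S k) ->
  (forall k, (K <= k)%N -> V k <= W k) ->
  (forall k, (K <= k)%N -> l - V k <= C * S k) ->
  exists B q : R, 0 < q < 1 /\ forall k, (K <= k)%N -> `|V k - l| <= B * q ^+ k.
Proof.
move=> C0 S_cvg S0 dec up VW low.
have W_anti k n : (K <= k)%N -> W (n + k)%N <= W k.
  move=> Kk; elim: n => [|n ih]; rewrite ?add0n// addSn.
  have Kn : (K <= n + k)%N by rewrite (leq_trans Kk)// leq_addl.
  by have := dec _ Kn; have := S0 _ Kn; lra.
have W_ge k : (K <= k)%N -> l <= W k.
  move=> Kk; apply/ler_addgt0Pr => e e0.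
  have : (fun n => C * S n) @ \oo --> (C * 0 : R).
    by apply: cvgM => //; exact: cvg_cst.
  rewrite mulr0 => /cvgr_lt/(_ e e0)[N _ hN].
  have Kn : (K <= N + k)%N by rewrite (leq_trans Kk)// leq_addl.
  have := hN (N + k)%N (leq_addr _ _); have := low _ Kn; have := VW _ Kn.
  by have := W_anti k N Kk => /=; lra.
pose q := C / (1 + C).
have C1 : 0 < 1 + C by lra.
have q0 : 0 < q by rewrite divr_gt0.
have contr k : (K <= k)%N -> W k.+1 - l <= q * (W k - l).
  move=> Kk; rewrite /q mulrAC ler_pdivlMr// -subr_ge0.
  have := up _ Kk; have := dec _ Kk; rewrite -(ler_pM2l C0); lra.
(* The factor [1 + C] covers the lower side, where [l - V k <= C * S k <= C * (W k - l)]. *)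
exists ((1 + C) * ((W K - l) * q ^- K)), q; split.
  by rewrite q0/= ltr_pdivrMr//; lra.
move=> k Kk; have Wk : W k - l <= (W K - l) * q ^- K * q ^+ k.
  rewrite -(subnK Kk); elim: (k - K)%N => [|n ih].
    by rewrite add0n mulfVK// expf_neq0// gt_eqF.
  rewrite addSn exprS mulrCA (le_trans (contr _ _)) ?leq_addl//.
  by rewrite ler_pM2l.
rewrite -mulrA; apply: le_trans (ler_wpM2l (ltW C1) Wk).
have VWk := VW _ Kk; have lowk := low _ Kk; have Wl := W_ge _ Kk.
have CW : 0 <= C * (W k - l) by rewrite mulr_ge0 ?subr_ge0// ltW.
have CS : C * S k <= C * (W k - l).
  rewrite ler_pM2l//; have := dec _ Kk; have := W_ge _ (leqW Kk); lra.
by rewrite ler_norml; apply/andP; split; lra.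
Qed.

Lemma R_linear_to_geometric (u : nat -> \bar R) (v : nat -> R) l B q K :
  0 < q < 1 ->
  (forall k, (K <= k)%N -> u k = (v k)%:E /\ `|v k - l| <= B * q ^+ k) ->
  R_linear_to u l.
Proof.
(* A ratio [r] strictly between [q] and 1 absorbs [B]: eventually [B * q ^+ k <= r ^+ k], whose
   [k]-th root is [r]. *)
move=> /andP[q0 q1] huv; pose r := (1 + q) / 2.
have qr : 0 < q / r < 1.
  by rewrite divr_gt0 /r ?divr_gt0//=; last lra; rewrite ltr_pdivrMr; lra.
have r0 : 0 < r by rewrite /r; lra.
have r1 : r < 1 by rewrite /r; lra.
have [N _ hN] : \forall k \near \oo, B * (q / r) ^+ k < 1.
  have : geometric B (q / r) @ \oo --> (0 : R).
    by apply: cvg_geometric; rewrite ger0_norm; lra.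
  by move=> /cvgr_lt/(_ 1 ltr01).
apply: (@le_lt_trans _ _ r%:E); last by rewrite lte_fin.
rewrite /limn_esup limf_esupE.
(* The 1 excludes [k = 0], where the exponent is 0. *)
pose A := [set k | (maxn N (maxn K 1) <= k)%N].
apply: (le_trans (ereal_inf_lbound _)).
  by exists A => //; exists (maxn N (maxn K 1)).
apply: ge_ereal_sup => _ [k + <-].
rewrite /A /= !geq_max => /and3P[Nk Kk k_gt0].
have [-> vk] := huv k Kk.
rewrite -EFinB abse_EFin poweR_EFin lee_fin.
have Bk : B * q ^+ k <= r ^+ k.
  have -> : q = (q / r) * r by rewrite divfK// gt_eqF.
  rewrite exprMn mulrA ler_piMl ?exprn_ge0 ?ltW//; exact: hN.
have k_neq0 : k%:R != 0 :> R by rewrite pnatr_eq0 -lt0n.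
have <- : (r ^+ k) `^ k%:R^-1 = r.
  by rewrite -powR_mulrn ?(ltW r0)// -powRrM divff// powRr1 ?(ltW r0).
apply: ge0_ler_powR; rewrite ?nnegrE ?exprn_ge0 ?(ltW r0) ?invr_ge0//.
exact: le_trans Bk.
Qed.

End Sequences.

(** * Estimates for one proximal step *)

Section Step.
Variables (R : realType) (d N : nat).
Variables (f : 'I_N -> 'rV[R]_d -> R) (h : 'rV[R]_d -> \bar R).
Hypotheses (h_proper : proper_fun h) (h_convex : convex_ereal h).
Implicit Types (g p u x y z : 'rV[R]_d) (c t E L M r s : R).

(** As [fine] sends infinite values to 0, this is the objective only where [h] is finite. *)
Definition value x : R := fsum f x + fine (h x).

Lemma objectiveE x : h x \is a fin_num -> objective f h x = (value x)%:E.
Proof. by move=> hx; rewrite /objective /value EFinD fineK. Qed.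

Lemma stationary_fin_num y : stationary f h y -> h y \is a fin_num.
Proof.
move=> [g hg _]; apply: proper_fin_num => //.
have [_ [x hx]] := h_proper; have := hg x.
by case: (h y) => [r|/le_lt_trans/(_ hx)|]//; rewrite ltry.
Qed.

Lemma prox_step_argmin L x : 0 < L -> closed_fun h ->
  (forall x, (h x < +oo)%E -> subdiff h x !=set0) ->
  argmin (fun u => h u + (qmodel (grad (fsum f) x) x (L / 2) u)%:E)%E
    (x + prox_residual f h L x).
Proof.
move=> L0 h_closed h_sub; set g := grad _ x.
pose obj u := (L^-1%:E * h u + (2^-1 * enorm (u - (x - L^-1 *: g)) ^+ 2)%:E)%E.
(* [K] is the constant left by completing the square: the objective of [prox] is [L^-1] times the
   model plus [K]. *)
pose K := L^-1 * (2^-1 * L^-1 * enorm g ^+ 2).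
have objE u : obj u =
    (L^-1%:E * (h u + (qmodel g x (L / 2) u)%:E) + K%:E)%E.
  rewrite muleDr ?fin_num_adde_defl// -EFinM -addeA -EFinD; congr (_ + _%:E)%E.
  rewrite /qmodel /K !enorm_sqr !dotE (dotC x u) (dotC g u) (dotC g x).
  by field; rewrite gt_eqF.
have obj_le u v : (obj u <= obj v)%E =
    (h u + (qmodel g x (L / 2) u)%:E <= h v + (qmodel g x (L / 2) v)%:E)%E.
  by rewrite !objE leeD2rE// lee_pmul2l// lte_fin invr_gt0.
have [x1 hx1] := h_proper.2.
have [p pmin] : argmin (fun u => h u + (qmodel g x (L / 2) u)%:E)%E !=set0.
  apply: argmin_model_exists => //; first by rewrite divr_gt0.
  by exists x1 => //; exact: h_sub.
have pobj : argmin obj p by move=> u; rewrite obj_le.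
have := getPex (ex_intro _ p pobj).
rewrite /prox_residual /prox addrC subrK -/(obj) => qmin u.
by rewrite -obj_le; exact: qmin.
Qed.

Definition residual_const c L E : R := 1 + (2 * c + L + 2 * E) / L.

(** The points [p] and [x + q], with [q] the residual, minimize two models with the same [h].
    Testing each three-point inequality at the other minimizer and adding cancels [h] and leaves the
    bound [key] on [L * enorm q ^+ 2]. *)
Lemma residual_le c L E s g x p : 0 < L -> 0 <= c -> 0 <= E -> closed_fun h ->
  (forall x, (h x < +oo)%E -> subdiff h x !=set0) ->
  argmin (fun u => h u + (qmodel g x c u)%:E)%E p ->
  enorm (p - x) <= s -> enorm (g - grad (fsum f) x) <= E * s ->
  enorm (prox_residual f h L x) <= residual_const c L E * s.
Proof.
move=> L0 c0 E0 h_closed h_sub pmin ps gs.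
have qmin := prox_step_argmin x L0 h_closed h_sub.
move: qmin gs; move: (prox_residual f h L x) (grad (fsum f) x) => q G qmin gs.
have [pfin /(_ (x + q)) p3] := argmin_three_point h_proper h_convex c0 pmin.
have L20 : 0 <= L / 2 by rewrite divr_ge0 ?ltW.
have [qfin /(_ p pfin) q3] := argmin_three_point h_proper h_convex L20 qmin.
have {}p3 := p3 qfin.
have key : L * enorm q ^+ 2 <= (2 * c + L) * dot (p - x) q +
    dot (g - G) q - dot (g - G) (p - x).
  have a0 := mulr_ge0 c0 (dot_ge0 (p - x)).
  move: p3 q3 a0; rewrite /qmodel.
  have -> : x + q - x = q by rewrite addrAC subrr add0r.
  have -> : x + q - p = q - (p - x) by rewrite opprB addrCA addrA.
  have -> : p - (x + q) = p - x - q by rewrite opprD addrA.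
  move: (p - x) => a; rewrite !enorm_sqr !dotE (dotC q a).
  lra.
have s0 : 0 <= s := le_trans (enorm_ge0 _) ps.
have b0 := enorm_ge0 q; set b := enorm q in b0 key *.
(* If [b <= s], the summand 1 of [residual_const] suffices; otherwise [s < b] bounds the term in
   [s ^+ 2] by one in [s * b], and [b] is divided out. *)
have [bs|sb] := leP b s.
  rewrite (le_trans bs)// ler_peMl// /residual_const lerDl divr_ge0 ?(ltW L0)//.
  lra.
have h1 : (2 * c + L) * dot (p - x) q <= (2 * c + L) * (s * b).
  by rewrite ler_wpM2l//; [lra|rewrite (le_trans (dot_le_enorm _ _))// ler_wpM2r].
have h2 : dot (g - G) q <= E * s * b.
  by rewrite (le_trans (dot_le_enorm _ _))// ler_wpM2r.
have h3 : - dot (g - G) (p - x) <= E * s * b.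
  rewrite -dotNl (le_trans (dot_le_enorm _ _))// enormN.
  by rewrite ler_pM ?enorm_ge0// (le_trans ps)// ltW.
have bp : 0 < b by apply: le_lt_trans sb.
have h4 : L * b <= (2 * c + L + 2 * E) * s by rewrite -(ler_pM2r bp); lra.
rewrite /residual_const [leRHS]mulrDl mul1r.
have : b <= (2 * c + L + 2 * E) / L * s by rewrite mulrAC ler_pdivlMr// mulrC.
lra.
Qed.

Definition gap_const c E K M : R :=
  (E + M) * (K + 1) + M * (K + 1) ^+ 2 + c * K ^+ 2.

(** The three-point inequality at [y] and the linearization of [f] at [p] bound the gap by [dot (g -
    grad (fsum f) p) (y - p) + M * enorm (y - p) ^+ 2 + c * enorm (y - x) ^+ 2]; the summands of
    [gap_const] match these terms. *)
Lemma value_gap_le c E K M r s g x p y :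
  0 <= c -> 0 <= E -> 0 <= K -> 0 <= M -> smooth M (fsum f) ->
  argmin (fun u => h u + (qmodel g x c u)%:E)%E p ->
  enorm (p - x) <= s -> enorm (g - grad (fsum f) x) <= E * s ->
  s <= r -> h y \is a fin_num -> enorm (x - y) <= K * r ->
  value p - value y <= gap_const c E K M * r ^+ 2.
Proof.
move=> c0 E0 K0 M0 smth pmin ps gs sr yfin yr.
have [pfin /(_ y yfin) p3] := argmin_three_point h_proper h_convex c0 pmin.
have := smooth_bregman_le p y M0 smth; rewrite ler_norml => /andP[breg _].
have r0 : 0 <= r by rewrite (le_trans _ sr)// (le_trans _ ps)// enorm_ge0.
have pr := le_trans ps sr.
have yp : enorm (y - p) <= (K + 1) * r.
  rewrite (le_trans (enorm_triangle x _ _))// mulrDl mul1r lerD//.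
    by rewrite enormB.
  by rewrite enormB.
have gp : enorm (g - grad (fsum f) p) <= (E + M) * r.
  rewrite (le_trans (enorm_triangle (grad (fsum f) x) _ _))// mulrDl lerD//.
    by rewrite (le_trans gs)// ler_wpM2l.
  by rewrite (le_trans (smth.2 _ _))// ler_wpM2l// enormB.
have h1 : dot (g - grad (fsum f) p) (y - p) <= (E + M) * r * ((K + 1) * r).
  by rewrite (le_trans (dot_le_enorm _ _))// ler_pM ?enorm_ge0.
have h2 : M * enorm (y - p) ^+ 2 <= M * ((K + 1) * r) ^+ 2.
  by rewrite ler_wpM2l// ler_sqr ?nnegrE ?enorm_ge0 ?mulr_ge0 ?addr_ge0.
have h3 : c * enorm (y - x) ^+ 2 <= c * (K * r) ^+ 2.
  by rewrite ler_wpM2l// enormB ler_sqr ?nnegrE ?enorm_ge0 ?mulr_ge0.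
have h4 : 0 <= c * enorm (p - x) ^+ 2 by rewrite mulr_ge0 ?sqr_ge0.
have h5 : 0 <= c * enorm (y - p) ^+ 2 by rewrite mulr_ge0 ?sqr_ge0.
have dE : dot g (y - x) - dot g (p - x) = dot g (y - p) by rewrite !dotE; ring.
move: h1 p3; rewrite /qmodel /value /gap_const dotDl dotNl.
move: breg h2 h3 h4 h5; rewrite !exprMn; lra.
Qed.

(** At [y] the subgradient of [h] is minus the gradient of [f], so the linear terms cancel and only
    the linearization error of [f] remains. *)
Lemma stationary_value_le M x y : 0 <= M -> smooth M (fsum f) ->
  h x \is a fin_num -> stationary f h y ->
  value y - value x <= M * enorm (x - y) ^+ 2.
Proof.
move=> M0 smth xfin ysta; have yfin := stationary_fin_num ysta.
have [g hg gE] := ysta.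
have := smooth_bregman_le y x M0 smth; rewrite ler_norml => /andP[breg _].
have := hg x; rewrite -(fineK xfin) -(fineK yfin) -EFinD lee_fin /=.
move: gE => /eqP; rewrite addrC addr_eq0 => /eqP ->; rewrite dotNl /value.
lra.
Qed.

(** The three-point inequality at [x] itself yields [2 * c], one [c] from the model and one from
    strong convexity; the gradient error is split by the arithmetic-geometric mean inequality. *)
Lemma value_descent c M E w g x p : 0 <= c -> 0 <= M -> 0 <= E -> 0 <= w ->
  smooth M (fsum f) -> h x \is a fin_num ->
  argmin (fun u => h u + (qmodel g x c u)%:E)%E p ->
  enorm (g - grad (fsum f) x) <= E * Num.sqrt w ->
  value p <= value x - (2 * c - M - E / 2) * enorm (p - x) ^+ 2 + E / 2 * w.
Proof.
move=> c0 M0 E0 w0 smth xfin pmin gw.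
have [pfin /(_ x xfin)] := argmin_three_point h_proper h_convex c0 pmin.
have := smooth_bregman_le x p M0 smth; rewrite ler_norml => /andP[_ breg].
rewrite /qmodel subrr (dotC g 0) -(scale0r 0) dotZl mul0r scale0r enorm0.
rewrite (enormB x p) => p3.
have cs : - dot (g - grad (fsum f) x) (p - x) <= E * Num.sqrt w * enorm (p - x).
  rewrite -dotNl (le_trans (dot_le_enorm _ _))// enormN.
  by rewrite ler_wpM2r ?enorm_ge0.
have am : E * (Num.sqrt w * enorm (p - x)) <= E * ((w + enorm (p - x) ^+ 2) / 2).
  rewrite ler_wpM2l// -[w in leRHS]sqr_sqrtr//.
  by have := sqr_ge0 (Num.sqrt w - enorm (p - x)); rewrite sqrrB; lra.
move: cs breg p3 am; rewrite /value dotDl dotNl; lra.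
Qed.

End Step.

(** * Gradient error caused by the delays *)

Section Delays.
Variables (R : realType) (d N : nat) (f : 'I_N -> 'rV[R]_d -> R).

Lemma dc_smooth_smooth (Ls ls : 'I_N -> R) : dc_smooth f Ls ls ->
  exists Ms : 'I_N -> R, forall i, 0 <= Ms i /\ smooth (Ms i) (f i).
Proof.
(* Absolute values make the constants nonnegative whatever the signs of [Ls i] and [ls i]. *)
move=> [f1 [f2 dc]]; exists (fun i => `|Ls i| + `|ls i|) => i.
have [fE [_ [d1 l1]] [_ [d2 l2]] _] := dc i.
have -> : f i = f1 i - f2 i by apply/funext.
split; first exact: addr_ge0.
split=> [x|x y]; first exact: differentiableB.
rewrite !gradB//.
have -> : grad (f1 i) x - grad (f2 i) x - (grad (f1 i) y - grad (f2 i) y) =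
  grad (f1 i) x - grad (f1 i) y + - (grad (f2 i) x - grad (f2 i) y).
  by apply/rowP => j; rewrite !mxE; ring.
rewrite (le_trans (enormD _ _))// enormN mulrDl lerD//.
  by rewrite (le_trans (l1 x y))// ler_wpM2r ?enorm_ge0// ler_norm.
by rewrite (le_trans (l2 x y))// ler_wpM2r ?enorm_ge0// ler_norm.
Qed.

Variable Ms : 'I_N -> R.
Hypothesis f_smooth : forall i, 0 <= Ms i /\ smooth (Ms i) (f i).

Lemma fsum_smooth : smooth (\sum_(i < N) Ms i) (fsum f).
Proof.
have df i x : differentiable (f i) x by exact: (f_smooth i).2.1.
split=> [x|x y].
  have -> : fsum f = \sum_(i < N) f i by apply/funext => z; rewrite fct_sumE.
  exact: differentiable_sum.
rewrite !grad_sum// -sumrB (le_trans (enorm_sum _))// mulr_suml.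
by apply: ler_sum => i _; exact: (f_smooth i).2.2.
Qed.

Variables (T : nat) (x : nat -> 'rV[R]_d).

Definition sqr_step (k : nat) : R := enorm (x k.+1 - x k) ^+ 2.

Lemma sqr_step_ge0 k : 0 <= sqr_step k.
Proof. exact: sqr_ge0. Qed.

Lemma delayed_iterate_le k t : (t <= T)%N ->
  enorm (x (k - t)%N - x k) <= T%:R * Num.sqrt (window T sqr_step k).
Proof.
set e := Num.sqrt _ => tT; apply: (@le_trans _ _ (t%:R * e)); last first.
  by rewrite ler_wpM2r ?sqrtr_ge0// ler_nat.
elim: t tT => [|t ih] tT; first by rewrite subn0 subrr enorm0 mul0r.
rewrite (le_trans (enorm_triangle (x (k - t)%N) _ _))// -natr1 mulrDl mul1r addrC.
rewrite lerD ?ih ?(ltnW tT)//.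
(* For [k <= t] both truncated indices are 0 and the step vanishes; otherwise it is a term of the
   window. *)
have [kt|tk] := leqP k t.
  move: (kt) (leqW kt); rewrite -!subn_eq0 => /eqP -> /eqP ->.
  by rewrite subrr enorm0 sqrtr_ge0.
rewrite -[leLHS]ger0_norm ?enorm_ge0// -sqrtr_sqr ler_wsqrtr//.
have := window_ge_term k (Ordinal tT) sqr_step_ge0.
by rewrite /= {1}/sqr_step -subn1 -subnDA add1n subnSK// enormB.
Qed.

Lemma agg_grad_error tau k : (forall i, (tau k i <= T)%N) ->
  enorm (agg_grad f tau x k - grad (fsum f) (x k)) <=
  (\sum_(i < N) Ms i) * T%:R * Num.sqrt (window T sqr_step k).
Proof.
move=> tauT; rewrite grad_sum => [|i]; last exact: (f_smooth i).2.1.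
rewrite -sumrB (le_trans (enorm_sum _))// -mulrA mulr_suml.
apply: ler_sum => i _; have [Mi [_ lip]] := f_smooth i.
by rewrite (le_trans (lip _ _))// ler_wpM2l// delayed_iterate_le.
Qed.

End Delays.

(** * Stepsize threshold and convergence of PIAG *)

Theorem theorem1 (R : realType) (d N : nat)
    (f : 'I_N -> 'rV[R]_d -> R) (h : 'rV[R]_d -> \bar R)
    (Ls ls : 'I_N -> R) (T : nat)
    (f_diff : forall i, differentiable_fun (f i))
    (L_gt0 : 0 < \sum_(i < N) Ls i)
    (A0 : exists m : R, forall x, (m%:E <= objective f h x)%E)
    (A1 : dc_smooth f Ls ls)
    (A2 : [/\ proper_fun h, closed_fun h, convex_ereal h &
            forall x, (h x < +oo)%E -> subdiff h x !=set0])
    (A4 : prox_error_bound f h (\sum_(i < N) Ls i))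
    (A5 : value_separation f h) :
  exists2 alpha0 : R, 0 < alpha0 &
    forall (alpha : R), 0 < alpha <= alpha0 ->
    forall (tau : nat -> 'I_N -> nat) (x : nat -> 'rV[R]_d),
      (forall k i, (1 <= k)%N -> (tau k i <= T)%N) ->
      PIAG f h alpha tau x ->
      (dist (x k) (stationary f h) @[k --> \oo] --> 0%E) /\
      R_linear (fun k => objective f h (x k)).
Proof.
have [Ms f_smooth] := dc_smooth_smooth A1.
have [h_proper h_closed h_convex h_sub] := A2.
set L := \sum_(i < N) Ls i in L_gt0 A4.
pose M := \sum_(i < N) Ms i.
have M0 : 0 <= M by apply: sumr_ge0 => i _; have [] := f_smooth i.
have smth : smooth M (fsum f) := fsum_smooth f_smooth.
pose E := M * T%:R; have E0 : 0 <= E by rewrite mulr_ge0.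
pose b := E / 2; have b0 : 0 <= b by rewrite divr_ge0.
have b10 : 0 <= b + 1 by rewrite addr_ge0.
(* As [2 * c] is the inverse of [alpha], this is the threshold at which the descent coefficient
   [2 * c - M - b] meets the demand of [lyapunov_decrease]. *)
pose a0 := (b + 1) * T%:R + 1 + M + b.
have a0_gt0 : 0 < a0.
  by have := mulr_ge0 b10 (ler0n R T); rewrite /a0; lra.
exists a0^-1 => [|alpha /andP[alpha0 alpha_le] tau x tauT piag].
  by rewrite invr_gt0.
pose c := (2 * alpha)^-1; have c0 : 0 <= c by rewrite invr_ge0 mulr_ge0// ltW.
have c2 : a0 <= 2 * c.
  rewrite /c invfM mulrA divff ?pnatr_eq0// mul1r.
  by rewrite -[a0]invrK lef_pV2 ?posrE ?invr_gt0.
pose D := sqr_step x; have D0 := sqr_step_ge0 x : forall j, 0 <= D j.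
pose w := window T D; pose S k := D k + w k.
have w0 k : 0 <= w k by apply: window_ge0.
have S0 k : 0 <= S k by rewrite addr_ge0.
pose s k := Num.sqrt (S k); have s0 k : 0 <= s k by rewrite sqrtr_ge0.
have step k : argmin (fun u => h u +
    (qmodel (agg_grad f tau x k) (x k) c u)%:E)%E (x k.+1) := piag k.
(* Estimates start at [k = 1]: [h (x 0)] may be infinite, and the delays are bounded only from there
   on. *)
have xfin k : (0 < k)%N -> h (x k) \is a fin_num.
  by case: k => // k _; have [] := argmin_three_point h_proper h_convex c0 (step k).
pose V k := value f h (x k); pose W := lyapunov T (b + 1) V D.
have xobj k : (0 < k)%N -> objective f h (x k) = (V k)%:E.
  by move=> k0; rewrite objectiveE ?xfin.
have err_w k : (0 < k)%N ->
    enorm (agg_grad f tau x k - grad (fsum f) (x k)) <= E * Num.sqrt (w k).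
  by move=> k0; apply: agg_grad_error => // i; exact: tauT.
have err k : (0 < k)%N ->
    enorm (agg_grad f tau x k - grad (fsum f) (x k)) <= E * s k.
  by move=> k0; rewrite (le_trans (err_w k k0))// ler_wpM2l// ler_wsqrtr// lerDr.
have step_le k : enorm (x k.+1 - x k) <= s k.
  by rewrite -[leLHS]ger0_norm ?enorm_ge0// -sqrtr_sqr ler_wsqrtr// lerDl.
have W_dec k : (0 < k)%N -> W k.+1 <= W k - S k.
  move=> k0; apply: (@lyapunov_decrease _ _ (2 * c - M - b)) => //.
    by rewrite /a0 in c2; lra.
  exact: (value_descent h_proper h_convex c0 M0 E0 (w0 k) smth (xfin k k0)
    (step k) (err_w k k0)).
have VW k : V k <= W k by apply: lyapunov_ge.
have [m hm] := A0.
have S_cvg : S @ \oo --> 0.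
  apply: (@decrements_cvg0 _ W S m 1) => // k k0.
  by rewrite (le_trans _ (VW k))// -lee_fin -xobj.
have s_cvg : s @ \oo --> 0.
  by rewrite -[X in _ --> X]sqrtr0; apply: continuous_cvg => //; exact: sqrt_continuous.
have W_le k : (0 < k)%N -> W k <= W 1%N.
  elim: k => // -[//|k] ih _; rewrite (le_trans (W_dec k.+1 _))//.
  by rewrite (le_trans _ (ih _))// gerBl.
(* The level [W 1] bounds the objective at every [x k] with [0 < k], since [V k <= W k <= W 1]. *)
have [|eps [c1 [eps0 c1_gt0 err_bound]]] := A4 (W 1%N).
  apply: (@le_trans _ _ (objective f h (x 1%N))).
    by apply: ereal_inf_lbound; exists (x 1%N).
  by rewrite xobj// lee_fin.
pose C1 := residual_const c L E.
have C1_gt0 : 0 < C1.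
  rewrite /C1 /residual_const ltr_wpDr// divr_ge0 ?(ltW L_gt0)//.
  by rewrite !addr_ge0 ?mulr_ge0 ?(ltW L_gt0).
have res k : (0 < k)%N -> enorm (prox_residual f h L (x k)) <= C1 * s k.
  by move=> k0; apply: (residual_le _ _ _ _ _ _ _ (step k)); rewrite ?err.
pose K := c1 * C1; have K0 : 0 < K by rewrite mulr_gt0.
have [n1 _ hn1] : \forall k \near \oo, s k < eps / C1.
  by move/cvgr_lt: s_cvg; apply; rewrite divr_gt0.
have dist_le k : (maxn n1 1 <= k)%N ->
    (dist (x k) (stationary f h) <= (K * s k)%:E)%E.
  rewrite geq_max => /andP[n1k k0].
  have resk := res k k0.
  apply: (le_trans (err_bound (x k) _ _)).
  - by rewrite (le_lt_trans resk)// mulrC -ltr_pdivlMr//; exact: hn1.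
  - by rewrite xobj// lee_fin (le_trans (VW k))// W_le.
  - by rewrite lee_fin /K -mulrA ler_pM2l.
split.
  apply: (@squeeze_cvge _ _ _ _ (cst 0%E) _ (fun k => (K * s k)%:E)).
  - exists (maxn n1 1) => // k /= kn; rewrite dist_le// andbT.
    by apply: le_ereal_inf_tmp => _ [y _ <-]; rewrite lee_fin enorm_ge0.
  - exact: cvg_cst.
  - apply: cvg_EFin; first exact: nearW.
    by rewrite -[X in _ --> X](mulr0 K); apply: cvgM => //; exact: cvg_cst.
have [delta delta0 sep] := A5.
(* Stationary points within [K * r0] of consecutive iterates are less than
   [(2 * K + 1) * r0 < delta] apart, so they share their value. *)
pose r0 := delta / (4 * (K + 1)).
have r0_gt0 : 0 < r0 by rewrite divr_gt0// mulr_gt0// addr_gt0.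
have r0E : 4 * ((K + 1) * r0) = delta.
  by rewrite /r0; field; rewrite gt_eqF// addr_gt0.
have Kr0 : 0 < K * r0 by rewrite mulr_gt0.
have [n2 _ hn2] : \forall k \near \oo, s k < r0.
  by move/cvgr_lt: s_cvg; apply.
pose n0 := maxn n2 (maxn n1 1).
have n0E k : (n0 <= k)%N -> [/\ s k < r0, (0 < k)%N & (maxn n1 1 <= k)%N].
  rewrite /n0 geq_max => /andP[n2k n1k]; split=> //; first exact: hn2.
  by move: n1k; rewrite geq_max => /andP[].
have near_stationary k r : (n0 <= k)%N -> s k < r ->
    exists2 y, stationary f h y & enorm (x k - y) < K * r.
  move=> /n0E[_ _ n1k] sr.
  have : (dist (x k) (stationary f h) < (K * r)%:E)%E.
    by rewrite (le_lt_trans (dist_le k n1k))// lte_fin ltr_pM2l.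
  by move=> /ereal_inf_lt[_ [y ysta <-]]; rewrite lte_fin; exists y.
have same_value u v : stationary f h u -> stationary f h v ->
    enorm (u - v) < delta -> value f h u = value f h v.
  move=> usta vsta uv; apply: EFin_inj.
  rewrite -!objectiveE ?(stationary_fin_num h_proper usta)//;
    last exact: (stationary_fin_num h_proper vsta).
  apply: contrapT => neq; have := sep _ _ usta vsta neq.
  by rewrite leNgt uv.
have [s_n0 _ _] := n0E n0 (leqnn n0).
have [y0 y0sta y0_near] := near_stationary n0 r0 (leqnn n0) s_n0.
pose l := value f h y0.
(* Induction along the iterates carries the value [l] from [y0] to every stationary point close to a
   later iterate. *)
have value_near k y : (n0 <= k)%N -> stationary f h y ->
    enorm (x k - y) <= K * r0 -> value f h y = l.
  move=> /subnK <-; elim: (k - n0)%N y => [|n ih] y ysta.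
    rewrite add0n => xy; apply: same_value => //.
    rewrite (le_lt_trans (enorm_triangle (x n0) _ _))// enormB.
    by move: y0_near xy; lra.
  rewrite addSn => xy; have n0n : (n0 <= n + n0)%N by rewrite leq_addl.
  have [sr _ _] := n0E _ n0n.
  have [y' y'sta y'_near] := near_stationary _ _ n0n sr.
  rewrite -(ih y')// ?(ltW y'_near)//; apply: same_value => //.
  rewrite (le_lt_trans (enorm_triangle (x (n + n0).+1) _ _))//.
  have := enorm_triangle (x (n + n0)%N) (x (n + n0).+1) y'.
  by rewrite (enormB y); have := step_le (n + n0)%N; lra.
pose G := gap_const c E K M.
have G0 : 0 <= G.
  by rewrite /G /gap_const !addr_ge0// mulr_ge0 ?sqr_ge0// addr_ge0// ltW.
have sS k : s k ^+ 2 = S k by rewrite sqr_sqrtr.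
have sr0 k : (n0 <= k)%N -> 0 <= s k < r0 by move=> /n0E[sr _ _]; rewrite s0.
have upper k : (n0 <= k)%N -> V k.+1 - l <= G * S k.
  move=> n0k; rewrite -sS; apply: (le_sqr_right_limit G0 (sr0 k n0k)) => r /andP[sr rr0].
  have [_ k0 _] := n0E k n0k.
  have [y ysta y_near] := near_stationary _ _ n0k sr.
  have Kr : enorm (x k - y) <= K * r := ltW y_near.
  rewrite -(value_near k y)//; last by rewrite (le_trans Kr)// ler_pM2l// ltW.
  exact: (value_gap_le h_proper h_convex c0 E0 (ltW K0) M0 smth (step k)
    (step_le k) (err k k0) (ltW sr) (stationary_fin_num h_proper ysta) Kr).
have lower k : (n0 <= k)%N -> l - V k <= M * K ^+ 2 * S k.
  move=> n0k; rewrite -sS.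
  apply: (le_sqr_right_limit _ (sr0 k n0k)); first by rewrite mulr_ge0 ?sqr_ge0.
  move=> r /andP[sr rr0]; have [_ k0 _] := n0E k n0k.
  have [y ysta y_near] := near_stationary _ _ n0k sr.
  have Kr : enorm (x k - y) <= K * r := ltW y_near.
  rewrite -(value_near k y)//; last by rewrite (le_trans Kr)// ler_pM2l// ltW.
  rewrite (le_trans (stationary_value_le h_proper M0 smth (xfin k k0) ysta))//.
  rewrite -mulrA -exprMn ler_wpM2l// ler_sqr ?nnegrE ?enorm_ge0// mulr_ge0 ?(ltW K0)//.
  exact: le_trans (s0 k) (ltW sr).
(* [G] and [(b + 1) * T%:R] serve the upper bound on [W k.+1 - l], [M * K ^+ 2] the lower bound on
   [V k], and 1 makes [C] positive. *)
pose C := G + (b + 1) * T%:R + M * K ^+ 2 + 1.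
have bT0 : 0 <= (b + 1) * T%:R by rewrite mulr_ge0.
have MK0 : 0 <= M * K ^+ 2 by rewrite mulr_ge0 ?sqr_ge0.
have [||||||B [q [q01 rate]]] := @geometric_rate R V W S l C n0 _ S_cvg.
- by rewrite /C; lra.
- by [].
- by move=> k /n0E[_ k0 _]; exact: W_dec.
- move=> k n0k; have := upper k n0k; have := @lyapunovS_le _ T (b + 1) V D k b10 D0.
  rewrite -/W -/(w k) -/(S k) mulrA => h1 h2.
  have : 0 <= (M * K ^+ 2 + 1) * S k by rewrite mulr_ge0// addr_ge0.
  by rewrite /C; lra.
- by [].
- move=> k n0k; have := lower k n0k.
  have : 0 <= (G + (b + 1) * T%:R + 1) * S k.
    by rewrite mulr_ge0//; move: G0 bT0; clear; lra.
  by rewrite /C; lra.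
exists l; apply: (R_linear_to_geometric q01 (v := V) (K := n0)) => k n0k.
by have [_ k0 _] := n0E k n0k; split; [exact: xobj|exact: rate].
Qed.
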